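(* Let $n\ge 2$, $d$ and $k>0$ be integers and let $\alpha\in\mathbb{R}$. If $G(\alpha;n,d,k)\neq\emptyset$, then $$d\ge\frac1k(n^2-1)-(n-k).$$
   Context: Work on the projective line $\mathbb{P}^1$ over an algebraically closed field. A coherent system of type $(n,d,k)$ is a pair $(E,V)$ where $E$ is a vector bundle of rank $n$ and degree $d$ on $\mathbb{P}^1$ and $V\subset H^0(E)$ is a vector subspace of dimension $k$. For $\alpha\in\mathbb{R}$ its $\alpha$-slope is $\mu_\alpha(E,V)=\frac{d}{n}+\alpha\frac{k}{n}$. A coherent subsystem of $(E,V)$ is a coherent system $(E',V')$ with $E'$ a (nonzero) subbundle of $E$ and $V'\subset V\cap H^0(E')$; it is proper if $(E',V')\neq(E,V)$. $(E,V)$ is $\alpha$-stable if $\mu_\alpha(E',V')<\mu_\alpha(E,V)$ for every proper coherent subsystem $(E',V')$. $G(\alpha;n,d,k)$ denotes the moduli space of $\alpha$-stable coherent systems of type $(n,d,k)$ on $\mathbb{P}^1$. *)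

(* Defs.v *)
From mathcomp Require Import all_boot all_order all_algebra.
From mathcomp Require Import classical_sets reals.

Set Implicit Arguments.
Unset Strict Implicit.
Unset Printing Implicit Defensive.

Import Order.TTheory GRing.Theory Num.Theory.
Local Open Scope classical_set_scope.
Local Open Scope ring_scope.

(* The projective line over F is covered by two affine lines, with coordinates
   t and s = t^-1; both coordinate rings are represented by {poly F} and both
   embed in the function field F(t). *)

Notation funfield F := {fraction {poly F}}.

Definition coord {F : closedFieldType} : funfield F := tofrac 'X.

Definition chart0 {F : closedFieldType} (p : {poly F}) : funfield F := tofrac p.

(* p(s) is sent to p(t^-1) *)
Definition chart1 {F : closedFieldType} (p : {poly F}) : funfield F :=
  (map_poly (fun c : F => tofrac c%:P) p).[coord^-1].

(* the subring F[t, t^-1] of functions regular on the overlap *)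
Definition laurent {F : closedFieldType} (x : funfield F) : Prop :=
  exists (p : {poly F}) (m : nat), x = chart0 p / coord ^+ m.

(* A vector bundle is free on each of the two charts (F[t] and F[s] are
   principal ideal domains), so it is given by a transition matrix g in
   GL_n(F[t, t^-1]); coordinate vectors f0 (over t) and f1 (over s) of the same
   section are related by f0 = g f1.  The units of F[t, t^-1] are the c t^d with
   c != 0, and the line bundle O(d) has transition function t^d, so the condition
   on det g says both that g is invertible over F[t, t^-1] and that the
   determinant bundle has degree d. *)
Record vbundle (F : closedFieldType) (n : nat) (d : int) := VBundle {
  trans : 'M[funfield F]_n;
  trans_laurent : forall i j, laurent (trans i j);
  trans_det : exists2 c : F, c != 0 & \det trans = chart0 c%:P * coord ^ d
}.

Notation vec2 F n := ('cV[{poly F}]_n * 'cV[{poly F}]_n)%type.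

Definition H0 (F : closedFieldType) (n : nat) (d : int) (E : vbundle F n d) :
    set (vec2 F n) :=
  [set f | map_mx chart0 f.1 = trans E *m map_mx chart1 f.2].

(* linear combinations with coefficients in the base field F *)
Definition lincomb (F : closedFieldType) (n k : nat) (b : 'I_k -> vec2 F n)
    (a : 'I_k -> F) : vec2 F n :=
  \sum_(i < k) (a i)%:P *: b i.

Definition subspace_of_dim (F : closedFieldType) (n k : nat)
    (V : set (vec2 F n)) : Prop :=
  exists b : 'I_k -> vec2 F n,
    (forall a : 'I_k -> F, lincomb b a = 0 -> forall i, a i = 0) /\
    V = range (lincomb b).

Record cohsys (F : closedFieldType) (n : nat) (d : int) (k : nat) := CohSys {
  bundle : vbundle F n d;
  secs : set (vec2 F n);
  secs_H0 : secs `<=` H0 bundle;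
  secs_dim : subspace_of_dim k secs
}.

(* a homomorphism of vector bundles, in the given frames on both charts *)
Record bhom (F : closedFieldType) (n' n : nat) (d' d : int)
    (E' : vbundle F n' d') (E : vbundle F n d) := BHom {
  hom0 : 'M[{poly F}]_(n, n');
  hom1 : 'M[{poly F}]_(n, n');
  hom_glue : map_mx chart0 hom0 *m trans E' = trans E *m map_mx chart1 hom1
}.

Definition bhom_sec (F : closedFieldType) (n' n : nat) (d' d : int)
    (E' : vbundle F n' d') (E : vbundle F n d) (h : bhom E' E)
    (f : vec2 F n') : vec2 F n :=
  (hom0 h *m f.1, hom1 h *m f.2).

(* inclusion of a subbundle: injective on the fibre at every point *)
Definition subbundle_hom (F : closedFieldType) (n' n : nat) (d' d : int)
    (E' : vbundle F n' d') (E : vbundle F n d) (h : bhom E' E) : Prop :=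
  forall a : F,
    \rank (map_mx (fun p : {poly F} => p.[a]) (hom0 h)) = n' /\
    \rank (map_mx (fun p : {poly F} => p.[a]) (hom1 h)) = n'.

Definition bundle_iso (F : closedFieldType) (n' n : nat) (d' d : int)
    (E' : vbundle F n' d') (E : vbundle F n d) (h : bhom E' E) : Prop :=
  exists h' : bhom E E',
    [/\ hom0 h *m hom0 h' = 1%:M, hom0 h' *m hom0 h = 1%:M,
        hom1 h *m hom1 h' = 1%:M & hom1 h' *m hom1 h = 1%:M].

Definition cohsys_iso (F : closedFieldType) (n' n : nat) (d' d : int)
    (k' k : nat) (X' : cohsys F n' d' k') (X : cohsys F n d k)
    (h : bhom (bundle X') (bundle X)) : Prop :=
  bundle_iso h /\ bhom_sec h @` secs X' = secs X.

Definition isomorphic (F : closedFieldType) (n : nat) (d : int) (k : nat)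
    (X Y : cohsys F n d k) : Prop :=
  exists h : bhom (bundle X) (bundle Y), cohsys_iso h.

Definition subsystem (F : closedFieldType) (n' n : nat) (d' d : int)
    (k' k : nat) (X' : cohsys F n' d' k') (X : cohsys F n d k)
    (h : bhom (bundle X') (bundle X)) : Prop :=
  [/\ (0 < n')%N, subbundle_hom h & bhom_sec h @` secs X' `<=` secs X].

(* the subsystem is all of X exactly when its inclusion is an isomorphism *)
Definition proper_subsystem (F : closedFieldType) (n' n : nat) (d' d : int)
    (k' k : nat) (X' : cohsys F n' d' k') (X : cohsys F n d k)
    (h : bhom (bundle X') (bundle X)) : Prop :=
  subsystem h /\ ~ cohsys_iso h.

Definition slope (R : realType) (alpha : R) (n : nat) (d : int) (k : nat) : R :=
  d%:~R / n%:R + alpha * (k%:R / n%:R).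

Definition stable (R : realType) (alpha : R) (F : closedFieldType) (n : nat)
    (d : int) (k : nat) (X : cohsys F n d k) : Prop :=
  forall (n' : nat) (d' : int) (k' : nat) (X' : cohsys F n' d' k')
         (h : bhom (bundle X') (bundle X)),
    proper_subsystem h -> slope alpha n' d' k' < slope alpha n d k.

(* the points of the moduli space G(alpha; n, d, k): isomorphism classes *)
Definition moduli (R : realType) (F : closedFieldType) (alpha : R) (n : nat)
    (d : int) (k : nat) : set (set (cohsys F n d k)) :=
  [set C | exists2 X : cohsys F n d k,
     stable alpha X & C = [set Y | isomorphic X Y]].
Arguments moduli {R} F alpha n d k.

(* Main.v *)
From HB Require Import structures.
From mathcomp Require Import all_boot all_order all_algebra all_fingroup.
From mathcomp Require Import classical_sets reals.
From mathcomp Require Import ring lra zify.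
Require Import Defs.

(** The inequality says that the Brill-Noether number
    1 - n^2 - k (k - d - n), the expected dimension of the moduli space, is
    nonnegative.  It is obtained by comparing dimensions along the map
    End(E) -> Hom(V, H^0(E)/V) of a stable system (E, V).

    A stable system is simple: an endomorphism of E preserving V is a scalar
    (stable_simple).  Subtracting an eigenvalue of its value at t = 0 makes its
    determinant vanish there; the determinant is a global function on the
    projective line, so it vanishes identically.  If the difference f is not
    zero, then its kernel and the saturation of its image are proper
    subbundles.  Together with ker f|V and f(V) they are subsystems whose ranks
    and dimensions add up to n and k, and whose degrees add up to at least d,
    as saturation does not lower the degree.  They cannot both have slope
    smaller than that of (E, V).  To have explicit frames for kernel and image,
    f is diagonalized separately on the two charts by invertible polynomial
    matrices (diagonalize_block); in the resulting frames the transition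
    matrices of E become block triangular.

    By the Birkhoff-Grothendieck theorem E is a sum of line bundles
    O(a_1), ..., O(a_n).  It is obtained here by reducing a polynomial
    transition matrix by row operations until the matrix of leading row
    coefficients is invertible (row_reduce): the row degrees are then the a_i
    up to a twist.  No a_i is negative, for otherwise V would have no component
    in O(a_i), and the projection to O(a_i) would be a nonscalar endomorphism
    preserving V.  Hence h^0(E) = sum (a_i + 1) = d + n, whereas
    dim End(E) = sum max(0, a_i - a_j + 1) is at least n^2.

    Simplicity says that the pairs (f, M) in End(E) x End(V) with f|V = M form
    a line.  As they are the kernel of a linear map to Hom(V, H^0(E)),
    n^2 + k^2 - 1 <= k (d + n) (endo_count), which is the claim. *)

Set Implicit Arguments.
Unset Strict Implicit.
Unset Printing Implicit Defensive.
Import Order.TTheory GRing.Theory Num.Theory.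
Local Open Scope classical_set_scope.
Local Open Scope ring_scope.

(** * Functions on the two charts *)

HB.instance Definition _ (F : closedFieldType) :=
  GRing.RMorphism.copy (@chart0 F) (@tofrac {poly F}).

Lemma coord_neq0 (F : closedFieldType) : coord != 0 :> funfield F.
Proof. by rewrite /coord tofrac_eq0 polyX_eq0. Qed.

Lemma chart0X (F : closedFieldType) : chart0 'X = coord :> funfield F.
Proof. by []. Qed.

Lemma chart1_zmod (F : closedFieldType) : zmod_morphism (@chart1 F).
Proof.
move=> p q; rewrite /chart1.
have -> : (fun c : F => tofrac c%:P) = @tofrac {poly F} \o polyC by [].
by rewrite rmorphB hornerD hornerN.
Qed.

Lemma chart1_monoid (F : closedFieldType) : monoid_morphism (@chart1 F).
Proof.
rewrite /chart1.
have -> : (fun c : F => tofrac c%:P) = @tofrac {poly F} \o polyC by [].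
by split=> [|p q]; rewrite ?rmorph1 ?hornerC // rmorphM hornerM.
Qed.

HB.instance Definition _ (F : closedFieldType) :=
  GRing.isZmodMorphism.Build _ _ (@chart1 F) (@chart1_zmod F).
HB.instance Definition _ (F : closedFieldType) :=
  GRing.isMonoidMorphism.Build _ _ (@chart1 F) (@chart1_monoid F).

Lemma chart1C (F : closedFieldType) (c : F) : chart1 c%:P = chart0 c%:P.
Proof.
rewrite /chart1; have -> : (fun c : F => tofrac c%:P) = @tofrac {poly F} \o polyC by [].
by rewrite map_polyC hornerC.
Qed.

Lemma chart1X (F : closedFieldType) : chart1 'X = coord^-1 :> funfield F.
Proof.
rewrite /chart1; have -> : (fun c : F => tofrac c%:P) = @tofrac {poly F} \o polyC by [].
by rewrite map_polyX hornerX.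
Qed.

Lemma chart0_inj (F : closedFieldType) : injective (@chart0 F).
Proof. by move=> p q /eqP; rewrite tofrac_eq => /eqP. Qed.

(** For q of degree at most m, this is t^m q(t^-1). *)
Definition rev_poly (F : closedFieldType) (m : nat) (q : {poly F}) : {poly F} :=
  \poly_(i < m.+1) q`_(m - i).

Lemma chart1_rev (F : closedFieldType) (m : nat) (q : {poly F}) :
  (size q <= m.+1)%N -> chart1 q * coord ^+ m = chart0 (rev_poly m q).
Proof.
move=> sq; have -> : q = \sum_(i < m.+1) q`_i *: 'X^i.
  by rewrite -poly_def; apply/polyP=> i; rewrite coef_poly; case: ltnP => // h;
    rewrite nth_default // (leq_trans sq).
rewrite rmorph_sum mulr_suml /rev_poly poly_def rmorph_sum /=.
rewrite (reindex_inj rev_ord_inj) /=; apply: eq_bigr => i _.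
rewrite -!mul_polyC !rmorphM !rmorphXn /= chart1C chart1X.
rewrite chart0X subSS -mulrA; congr (chart0 _%:P * _).
  rewrite coef_sum (bigD1 (rev_ord i)) //= subSS coefZ coefXn eqxx mulr1.
  rewrite big1 ?addr0 // => j /eqP ji; rewrite coefZ coefXn.
  case: eqP => [e|]; last by rewrite mulr0.
  by case: ji; apply/val_inj; rewrite /= subSS.
have le : (i <= m)%N by rewrite -ltnS.
have <- : coord ^+ (m - i) * coord ^+ i = coord ^+ m :> funfield F.
  by rewrite -exprD subnK.
rewrite mulrA -exprMn mulVf ?coord_neq0 //.
by rewrite expr1n mul1r.
Qed.

Lemma coef_rev (F : closedFieldType) (m : nat) (q : {poly F}) i :
  (rev_poly m q)`_i = if (i < m.+1)%N then q`_(m - i) else 0.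
Proof. by rewrite coef_poly. Qed.

Lemma coord_zD (F : closedFieldType) (a b : int) :
  coord ^ (a + b) = coord ^ a * coord ^ b :> funfield F.
Proof. by rewrite expfzDr ?coord_neq0. Qed.

(** The sections of the line bundle O(a) are the polynomials of degree at most a.
    Writing a = A - B and clearing denominators turns the gluing condition into
    an equality of polynomials whose right hand side has degree at most A + m. *)
Lemma chart_glue_coef (F : closedFieldType) (a : int) (p q : {poly F}) :
  chart0 p = coord ^ a * chart1 q -> forall i : nat, a < i%:Z -> p`_i = 0.
Proof.
move=> e.
have [A [B eA]] : exists A B : nat, a = A%:Z - B%:Z.
  by case: a {e} => m; [exists m, 0%N | exists 0%N, m.+1]; lia.
move=> i ai; set m := size q.
have e2 : p * 'X^(B + m) = 'X^A * rev_poly m q.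
  apply: chart0_inj; rewrite !rmorphM !rmorphXn /= !chart0X.
  have eB : coord ^ a * coord ^+ B = coord ^+ A :> funfield F.
    by rewrite (exprnP _ B) -coord_zD eA subrK -exprnP.
  by rewrite -chart1_rev ?leqnSn // e exprD -eB; ring.
have := congr1 (fun r : {poly F} => r`_(i + (B + m))) e2.
rewrite coefMXn [in RHS]mulrC coefMXn coef_rev ltnNge leq_addl addnK /= => ->.
case: ltnP => // h; case: ifP => // h2; lia.
Qed.

(** Conversely, t^i = t^a (t^-1)^(a - i) for i <= a. *)
Lemma glue_chart (F : closedFieldType) (a : int) (p : {poly F}) :
  (forall i : nat, a < i%:Z -> p`_i = 0) ->
  exists q, chart0 p = coord ^ a * chart1 q.
Proof.
move=> h; exists (\sum_(i < size p) p`_i *: 'X^`|a - i%:Z|%N).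
rewrite -{1}[p]coefK poly_def !rmorph_sum mulr_sumr /=.
apply: eq_bigr => i _; case: (ltrP a i%:Z) => ai.
  by rewrite h // !scale0r !rmorph0 mulr0.
rewrite -!mul_polyC !rmorphM !rmorphXn /= chart1C chart0X chart1X.
rewrite mulrCA; congr (_ * _); rewrite exprnP exprnP exprz_inv -coord_zD.
by congr (_ ^ _); lia.
Qed.

Lemma chart1_inj (F : closedFieldType) : injective (@chart1 F).
Proof.
move=> p q /eqP; rewrite -subr_eq0 -rmorphB => /eqP.
set r := p - q => e; apply/eqP; rewrite -subr_eq0 -/r; apply/eqP/polyP=> i.
have := chart1_rev (leqnSn (size r)); rewrite e mul0r -[0](rmorph0 chart0).
move/chart0_inj/esym => e2; rewrite coef0.
case: (ltnP i (size r)) => h; last by rewrite nth_default.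
have := congr1 (fun s : {poly F} => s`_(size r - i)) e2.
by rewrite coef_rev coef0 ltnS leq_subr subKn // ltnW.
Qed.

Lemma coord_z_neq0 (F : closedFieldType) (a : int) : coord ^ a != 0 :> funfield F.
Proof. by rewrite expfz_neq0 ?coord_neq0. Qed.

Lemma global_function_const (F : closedFieldType) (p q : {poly F}) :
  chart0 p = chart1 q -> exists c, p = c%:P /\ q = c%:P.
Proof.
move=> e; have pc : p = (p`_0)%:P.
  apply/polyP=> [[|i]]; rewrite coefC //=.
  by apply: (@chart_glue_coef _ 0 p q); rewrite // ?expr0z ?mul1r.
exists p`_0; split=> //; apply: chart1_inj.
by rewrite -e chart1C -pc.
Qed.

Lemma chart0_eq0 (F : closedFieldType) (p : {poly F}) : (chart0 p == 0) = (p == 0).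
Proof. exact: tofrac_eq0. Qed.

Lemma laurent_chart0 (F : closedFieldType) (p : {poly F}) : laurent (chart0 p).
Proof. by exists p, 0%N; rewrite expr0 divr1. Qed.

Lemma laurent_chart1 (F : closedFieldType) (p : {poly F}) : laurent (chart1 p).
Proof.
exists (rev_poly (size p) p), (size p).
by rewrite -chart1_rev ?leqnSn // mulfK // expf_neq0 // coord_neq0.
Qed.

Lemma laurentM (F : closedFieldType) (x y : funfield F) :
  laurent x -> laurent y -> laurent (x * y).
Proof.
move=> [p [m ->]] [q [l ->]]; exists (p * q), (m + l)%N.
by rewrite rmorphM exprD invfM mulrACA.
Qed.

Lemma laurentD (F : closedFieldType) (x y : funfield F) :
  laurent x -> laurent y -> laurent (x + y).
Proof.
move=> [p [m ->]] [q [l ->]]; exists (p * 'X^l + q * 'X^m), (m + l)%N.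
rewrite rmorphD !rmorphM !rmorphXn /= chart0X exprD.
by rewrite addf_div ?expf_neq0 ?coord_neq0.
Qed.

Lemma laurent_sum (F : closedFieldType) (I : Type) (r : seq I) (P : pred I)
    (x : I -> funfield F) :
  (forall i, laurent (x i)) -> laurent (\sum_(i <- r | P i) x i).
Proof.
move=> h; apply: (big_ind (@laurent F)) => //; last exact: laurentD.
by rewrite -(rmorph0 chart0); apply: laurent_chart0.
Qed.

Lemma laurent_prod (F : closedFieldType) (I : Type) (r : seq I) (P : pred I)
    (x : I -> funfield F) :
  (forall i, laurent (x i)) -> laurent (\prod_(i <- r | P i) x i).
Proof.
move=> h; apply: (big_ind (@laurent F)) => //; last exact: laurentM.
by rewrite -(rmorph1 chart0); apply: laurent_chart0.
Qed.

Lemma laurent_mulmx (F : closedFieldType) m n p (A : 'M[funfield F]_(m, n))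
    (B : 'M[funfield F]_(n, p)) :
  (forall i j, laurent (A i j)) -> (forall i j, laurent (B i j)) ->
  forall i j, laurent ((A *m B) i j).
Proof.
move=> hA hB i j; rewrite mxE; apply: laurent_sum => l; exact: laurentM.
Qed.

Lemma laurent_det (F : closedFieldType) n (A : 'M[funfield F]_n) :
  (forall i j, laurent (A i j)) -> laurent (\det A).
Proof.
move=> hA; apply: laurent_sum => s; apply: laurentM; last exact: laurent_prod.
by rewrite -(rmorph_sign chart0); apply: laurent_chart0.
Qed.

Lemma laurent_common (F : closedFieldType) m n (A : 'M[funfield F]_(m, n)) :
  (forall i j, laurent (A i j)) ->
  exists (N : nat) (G : 'M[{poly F}]_(m, n)), coord ^+ N *: A = map_mx chart0 G.
Proof.
move=> hA.
have h1 i j : exists pm : {poly F} * nat, A i j = chart0 pm.1 / coord ^+ pm.2.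
  by have [p [l e]] := hA i j; exists (p, l).
pose w i j := boolp.cid (h1 i j).
pose N := (\max_i \max_j (sval (w i j)).2)%N.
exists N, (\matrix_(i, j) ((sval (w i j)).1 * 'X^(N - (sval (w i j)).2))).
apply/matrixP => i j; rewrite !mxE; have e := svalP (w i j).
set pm := sval (w i j) in e *; rewrite {}e rmorphM rmorphXn /= chart0X.
have le : (pm.2 <= N)%N.
  apply: leq_trans (leq_bigmax (F := fun i => \max_j (sval (w i j)).2)%N i).
  exact: (leq_bigmax (F := fun j => (sval (w i j)).2) j).
rewrite mulrCA; congr (_ * _); rewrite -{1}(subnK le) exprD mulfK //.
by rewrite expf_neq0 ?coord_neq0.
Qed.

Fact cross_multiply (K : fieldType) (p q c x y z w : K) :
  x != 0 -> y != 0 -> z != 0 -> p / x * (q / y) = c * (w / z) ->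
  p * q * z = c * (w * (x * y)).
Proof.
move=> x0 y0 z0 e; have -> : p * q * z = (p / x * (q / y)) * (x * y * z).
  by field; rewrite x0 y0.
by rewrite e; field; rewrite z0.
Qed.

(** Clearing denominators, the numerator of x divides a power of 'X. *)
Lemma laurent_unit (F : closedFieldType) (x y : funfield F) (c : F) (d : int) :
  laurent x -> laurent y -> c != 0 -> x * y = chart0 c%:P * coord ^ d ->
  exists (a : int) (c' : F), c' != 0 /\ x = chart0 c'%:P * coord ^ a.
Proof.
move=> [p [m ->]] [q [l ->]] c0 e.
have [N [M eN]] : exists N M : nat, d = N%:Z - M%:Z.
  by case: d {e} => i; [exists i, 0%N | exists 0%N, i.+1]; lia.
have e2 : p * q * 'X^M = c%:P * 'X^(N + (m + l)).
  apply: chart0_inj; rewrite !rmorphM !rmorphXn /= !chart0X.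
  move: e; rewrite eN coord_zD -!exprnN => e.
  have u k : coord ^+ k != 0 :> funfield F by rewrite expf_neq0 // coord_neq0.
  rewrite !exprD; apply: cross_multiply; rewrite ?u //.
have pd : p %| ('X - 0%:P) ^+ (N + (m + l)).
  rewrite subr0 -(dvdpZr _ _ c0) -mul_polyC -e2 -mulrA dvdp_mulr //.
have /dvdp_exp_XsubCP[k kl] := pd; rewrite subr0 => /eqpfP.
rewrite (lead_coefXn) divr1 => ep.
have p0 : p != 0.
  apply/eqP => p0; move/eqP: e2; rewrite p0 !mul0r eq_sym mulf_eq0 polyC_eq0.
  by rewrite (negPf c0) expf_eq0 polyX_eq0 andbF.
exists (k%:Z - m%:Z), (lead_coef p); rewrite lead_coef_eq0; split=> //.
rewrite {1}ep -mul_polyC rmorphM rmorphXn /= chart0X coord_zD -!exprnN.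
by rewrite mulrA.
Qed.

(** * Splitting of vector bundles on the projective line *)

Lemma map_unitmx (A B : comUnitRingType) (phi : {rmorphism A -> B}) n
    (U : 'M[A]_n) : U \in unitmx -> map_mx phi U \in unitmx.
Proof. by rewrite !unitmxE det_map_mx => u; apply: rmorph_unit. Qed.

Lemma det_unit_const (F : fieldType) n (U : 'M[{poly F}]_n) : U \in unitmx ->
  exists2 u : F, u != 0 & \det U = u%:P.
Proof.
rewrite unitmxE poly_unitE => /andP[/size_poly1P[u u0 ->] _].
by exists u.
Qed.

Lemma transvection_unit (R : comUnitRingType) n (i : 'I_n) (w : 'rV[R]_n) :
  w 0 i = 0 -> 1%:M + delta_mx i 0 *m w \in unitmx.
Proof.
move=> wi; suff: (1%:M + delta_mx i 0 *m w) *m (1%:M - delta_mx i 0 *m w) = 1%:M.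
  by case/mulmx1_unit.
have we : w *m delta_mx i 0 = 0 :> 'M_1.
  by rewrite -colE; apply/matrixP => a b; rewrite !ord1 !mxE.
rewrite mulmxDl mul1mx mulmxBr mulmx1 mulmxA -(mulmxA _ w) we mulmx0 mul0mx.
by rewrite subr0 subrK.
Qed.

(** A linear relation between the leading row coefficients allows a row of
    maximal degree among those involved to be replaced by a combination of lower
    degree.  The sum of the row degrees decreases, so this stops, and it can only
    stop at an invertible leading matrix; a row never drops below degree 0
    because the determinant does not vanish. *)
Lemma row_reduce (F : fieldType) n (G : 'M[{poly F}]_n) (r : 'I_n -> nat) :
  \det G != 0 -> (forall i j, size (G i j) <= (r i).+1)%N ->
  exists (U : 'M[{poly F}]_n) (r' : 'I_n -> nat),
  [/\ U \in unitmx, (forall i j, size ((U *m G) i j) <= (r' i).+1)%N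
    & (\matrix_(i, j) ((U *m G) i j)`_(r' i)) \in unitmx].
Proof.
have [N] := ubnP (\sum_i r i)%N; elim: N => // N IH in G r *.
move=> rN dG sG; pose L := \matrix_(i, j) (G i j)`_(r i).
case: (boolP (L \in unitmx)) => uL.
  by exists 1%:M, r; rewrite mul1mx unitmx1.
move: uL; rewrite unitmxE unitfE negbK => /det0P[v v0 vL].
have /rV0Pn[i1 vi1] := v0.
case: (arg_maxnP (P := fun i => v 0 i != 0) r vi1) => i0 vi0 maxi0.
pose u j := v 0 j / v 0 i0.
(* The powers of 'X lift each row involved to the degree of row i0, so that
   the leading terms cancel. *)
pose w : 'rV[{poly F}]_n :=
  \row_j (if j == i0 then 0 else (u j)%:P * 'X^(r i0 - r j)).
pose T := 1%:M + delta_mx i0 0 *m w.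
have uT : T \in unitmx by apply: transvection_unit; rewrite mxE eqxx.
have TE i j : (T *m G) i j = if i == i0 then
    \sum_l (u l)%:P * 'X^(r i0 - r l) * G l j else G i j.
  rewrite /T mulmxDl mul1mx mxE -mulmxA [(delta_mx _ _ *m _) i j]mxE big_ord1.
  rewrite [delta_mx _ _ _ _]mxE eqxx andbT; case: eqP => [->|_]; last first.
    by rewrite mul0r addr0.
  rewrite mul1r mxE [RHS](bigD1 i0) //= subnn expr0 mulr1 /u divff // mul1r.
  congr (_ + _); rewrite (bigD1 i0) //= mxE eqxx mul0r add0r.
  by apply: eq_bigr => l li; rewrite mxE (negPf li).
have s0 j : (size ((T *m G) i0 j) <= r i0)%N.
  rewrite TE eqxx; apply/leq_sizeP => t le_t; rewrite coef_sum.
  have := congr1 (fun M : 'rV_n => M 0 j) vL; rewrite !mxE => e0.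
  transitivity (\sum_l if t == r i0 then v 0 l * L l j / v 0 i0 else 0); last first.
    by case: eqP => _; rewrite -?mulr_suml ?e0 ?mul0r // big1.
  apply: eq_bigr => l _; rewrite -mulrA coefCM coefXnM /u mxE.
  have [->|vl] := eqVneq (v 0 l) 0; first by rewrite !mul0r if_same.
  have le_l := maxi0 l vl; rewrite ltnNge (leq_trans (leq_subr _ _) le_t) /=.
  case: eqP => [->|ne]; first by rewrite subKn // mulrAC.
  rewrite nth_default ?mulr0 // (leq_trans (sG l j)) //; lia.
have dTG : \det (T *m G) != 0.
  by rewrite det_mulmx mulf_neq0 //; apply: contraL uT => /eqP e; rewrite unitmxE e unitr0.
have r0 : (0 < r i0)%N.
  rewrite lt0n; apply: contraNneq dTG => e; rewrite (expand_det_row _ i0) big1 //.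
  by move=> j _; have := s0 j; rewrite e leqn0 size_poly_eq0 => /eqP->; rewrite mul0r.
have [|||U [r' [uU h1 h2]]] := IH (T *m G) (fun i => if i == i0 then (r i0).-1 else r i).
- move: rN; rewrite (bigD1 i0) //= [X in (_ -> X < _)%N](bigD1 i0) //= eqxx.
  rewrite [X in (_ -> _ + X < _)%N](eq_bigr r) => [|i /negPf->//]; lia.
- exact: dTG.
- move=> i j; case: eqP => [->|/eqP ne]; first by rewrite prednK.
  by rewrite TE (negPf ne).
exists (U *m T), r'; rewrite unitmx_mul uU uT -mulmxA; split=> //.
Qed.

Section bg.
Variables (F : closedFieldType).

(** At t = infinity both c and p(t^-1) take nonzero finite values, so e = 0. *)
Lemma coord_det_constant (c : F) (e : int) (p : {poly F}) :
  c != 0 -> p`_0 != 0 -> chart0 c%:P = coord ^ e * chart1 p -> p = c%:P.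
Proof.
move=> c0 p0 h.
have e0 : 0 <= e.
  rewrite leNgt; apply: contra c0 => /(chart_glue_coef h).
  by rewrite coefC /= => ->.
case: e e0 h => // e _ h.
have h2 : p = c%:P * 'X^e.
  apply: chart1_inj; rewrite rmorphM rmorphXn /= chart1C h chart1X exprVn.
  by rewrite -exprnP mulrAC mulfV ?mul1r // expf_neq0 ?coord_neq0.
move: p0; rewrite h2 coefMXn coefC; case: e {h h2} => [|e]; last by rewrite eqxx.
by rewrite expr0 mulr1.
Qed.

Lemma coord_z_eq1 (a : int) : coord ^ a = 1 :> funfield F -> a = 0.
Proof.
have h b : coord ^ b = 1 :> funfield F -> 0 <= b.
  move=> e; rewrite leNgt; apply/negP => b0.
  have := @chart_glue_coef F b 1 1; rewrite e !rmorph1 mulr1 => /(_ erefl 0%N b0).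
  by rewrite coefC => /eqP; rewrite oner_eq0.
move=> e; have e' : coord ^ (- a) = 1 :> funfield F by rewrite -invr_expz e invr1.
have := h _ e; have := h _ e'; lia.
Qed.

(** Once t^N times the transition matrix is polynomial and row reduced, dividing
    each row by the power of t given by its degree leaves a polynomial matrix C
    in t^-1 whose value at infinity is the matrix of leading coefficients.  Its
    determinant is a constant times a power of t^-1, so invertibility at infinity
    makes it invertible. *)
Theorem Birkhoff_Grothendieck n (d : int) (E : vbundle F n d) :
  exists (a : 'I_n -> int) (P Q : 'M[{poly F}]_n),
  [/\ P \in unitmx, Q \in unitmx, \sum_i a i = d &
    trans E = map_mx chart0 P *m diag_mx (\row_i coord ^ a i) *m map_mx chart1 Q].
Proof.
have [N [G eG]] := laurent_common (@trans_laurent F n d E).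
have [c c0 dE] := trans_det E.
have dG : chart0 (\det G) = chart0 c%:P * coord ^ (d + (N * n)%:Z).
  by rewrite -det_map_mx -eG detZ dE coord_zD -[coord ^ (N * n)%:Z]exprnP exprM mulrC mulrA.
have nG : \det G != 0.
  by rewrite -chart0_eq0 dG mulf_neq0 ?coord_z_neq0 // chart0_eq0 polyC_eq0.
have [||U [r [uU sr uL]]] := @row_reduce F n G (fun i => \max_j size (G i j))%N.
- exact: nG.
- by move=> i j; rewrite ltnW // ltnS (leq_bigmax (F := fun j => size (G i j))).
move: sr uL; move eV : (U *m G) => V sr uL.
pose C := \matrix_(i, j) rev_poly (r i) (V i j).
have eC : map_mx chart0 V = diag_mx (\row_i coord ^+ r i) *m map_mx chart1 C.
  rewrite mul_diag_mx; apply/matrixP=> i j; rewrite !mxE.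
  have s2 : (size (C i j) <= (r i).+1)%N by rewrite mxE size_poly.
  have e2 := chart1_rev s2; rewrite mulrC in e2.
  transitivity (chart0 (rev_poly (r i) (C i j))); last by rewrite -e2 !mxE.
  rewrite !mxE; congr chart0.
  apply/polyP=> t; rewrite coef_rev; have := sr i j => s3.
  case: ltnP => ht; last by rewrite nth_default // (leq_trans s3).
  by rewrite coef_rev ltnS leq_subr subKn.
have [u u0 eu] := det_unit_const uU.
have dC : chart0 (u * c)%:P =
    coord ^ ((\sum_i r i)%:Z - (d + (N * n)%:Z)) * chart1 (\det C).
  have := congr1 determinant eC.
  rewrite -eV det_mulmx det_diag !det_map_mx det_mulmx rmorphM /= eu dG.
  have -> : \prod_i (\row_i0 coord ^+ r i0) 0 i = coord ^ (\sum_i r i)%:Z :> funfield F.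
    rewrite -[in RHS]exprnP -prodrXr.
    by under eq_bigr do rewrite mxE.
  move=> e; apply: (mulfI (coord_z_neq0 F (d + (N * n)%:Z))).
  rewrite mulrA -coord_zD [_ + (_ - _)]addrC subrK -e polyCM.
  by rewrite [chart0 (_ * _)]rmorphM /= mulrC mulrA.
have C0 : (\det C)`_0 != 0.
  have -> : (\det C)`_0 = \det (map_mx (horner_eval 0) C).
    by rewrite det_map_mx /= /horner_eval horner_coef0.
  have -> : map_mx (horner_eval 0) C = \matrix_(i, j) (V i j)`_(r i).
    apply/matrixP=> i j; rewrite [LHS]mxE /horner_eval horner_coef0 mxE coef_rev.
    by rewrite subn0 mxE.
  by move: uL; rewrite unitmxE unitfE.
have uc0 : u * c != 0 by rewrite mulf_neq0.
have detC := coord_det_constant uc0 C0 dC.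
have uC : C \in unitmx.
  by rewrite unitmxE detC poly_unitE size_polyC coefC uc0 /= unitfE.
have hsum : (\sum_i r i)%:Z - (d + (N * n)%:Z) = 0.
  apply: coord_z_eq1; apply: (@mulIf _ (chart0 (u * c)%:P)).
    by rewrite chart0_eq0 polyC_eq0.
  by rewrite mul1r [RHS]dC detC chart1C.
exists (fun i => (r i)%:Z - N%:Z), (invmx U), C; split=> //.
- by rewrite unitmx_inv.
- rewrite sumrB sumr_const card_ord -mulr_natr -(big_morph Posz PoszD erefl) natz.
  by move: hsum; rewrite PoszM; lia.
- have uU0 := map_unitmx (@chart0 F) uU.
  apply: (can_inj (mulKmx uU0)).
  rewrite !mulmxA -map_mxM mulmxV // map_mx1 mul1mx.
  have cN : coord ^+ N != 0 :> funfield F by rewrite expf_neq0 ?coord_neq0.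
  apply: (can_inj (scalerK cN)); rewrite scalemxAr eG -map_mxM /= eV eC scalemxAl.
  congr (_ *m _); rewrite -[_ *: _]/(_ *: diag_mx _) -linearZ /=; congr diag_mx.
  apply/rowP => i; rewrite !mxE coord_zD mulrCA [coord ^+ N]exprnP -coord_zD addrN.
  by rewrite expr0z mulr1.
Qed.
End bg.

(** * Diagonal form of polynomial matrices *)

Section diag.
Variable F : fieldType.

Local Notation o m := (lshift m (0 : 'I_1)).

(** Euclidean division by the corner entry: any nonzero remainder in the first
    column or row is moved to the corner, where it has smaller degree. *)
Lemma clear_first_row_col m n (A : 'M[{poly F}]_(1 + m, 1 + n)) : A (o m) (o n) != 0 ->
  exists (P : 'M[{poly F}]_(1 + m)) (Q : 'M[{poly F}]_(1 + n)) (a : {poly F})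
    (B : 'M[{poly F}]_(m, n)),
  [/\ P \in unitmx, Q \in unitmx, a != 0 & P *m A *m Q = block_mx a%:M 0 0 B].
Proof.
have [N] := ubnP (size (A (o m) (o n))); elim: N => // N IH in A * => sA A0.
have step (P : 'M_(1 + m)) (Q : 'M_(1 + n)) : P \in unitmx -> Q \in unitmx ->
    (P *m A *m Q) (o m) (o n) != 0 -> (size ((P *m A *m Q) (o m) (o n)) < size (A (o m) (o n)))%N ->
    exists (P : 'M[{poly F}]_(1 + m)) (Q : 'M[{poly F}]_(1 + n)) (a : {poly F})
      (B : 'M[{poly F}]_(m, n)),
    [/\ P \in unitmx, Q \in unitmx, a != 0 & P *m A *m Q = block_mx a%:M 0 0 B].
  move=> uP uQ n0 lt0; have [|//|P' [Q' [b [B [uP' uQ' b0 e]]]]] := IH (P *m A *m Q).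
    exact: leq_trans lt0 _.
  exists (P' *m P), (Q *m Q'), b, B; rewrite !unitmx_mul uP uQ uP' uQ'; split=> //.
  by rewrite -e !mulmxA.
set a := A (o m) (o n) in sA A0 step *.
pose u := ursubmx A; pose v := dlsubmx A; pose B := drsubmx A.
have eA : A = block_mx a%:M u v B.
  rewrite -[LHS]submxK; congr block_mx; apply/matrixP => i j; rewrite !ord1 !mxE /=.
  by rewrite mulr1n.
pose P1 : 'M_(1 + m) := block_mx 1%:M 0 (- map_mx (fun p => p %/ a) v) 1%:M.
have uP1 : P1 \in unitmx by rewrite unitmxE det_lblock !det1 mulr1 unitr1.
pose B1 := B - map_mx (fun p => p %/ a) v *m u.
have e1 : P1 *m A = block_mx a%:M u (map_mx (fun p => p %% a) v) B1.
  rewrite eA mulmx_block !mul1mx !mul0mx !addr0 mulNmx addrC; congr block_mx.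
    apply/matrixP=> i j; rewrite mul_mx_scalar !mxE mulrC.
    by rewrite {1}(divp_eq (A (rshift 1 i) (lshift n j)) a) addrAC subrr add0r.
  by rewrite mulNmx addrC.
have [i vi|v0] := pickP (fun i => v i 0 %% a != 0).
  have e2 : (tperm_mx (o m) (rshift 1 i) *m P1 *m A *m 1%:M) (o m) (o n) = v i 0 %% a.
    by rewrite mulmx1 -mulmxA e1 -xrowE mxE tpermL block_mxEdl mxE.
  apply: (step (tperm_mx (o m) (rshift 1 i) *m P1) 1%:M); rewrite ?unitmx1 ?e2 //.
    by rewrite unitmx_mul unitmx_perm.
  by rewrite ltn_modp.
have v0' : map_mx (fun p => p %% a) v = 0.
  by apply/matrixP=> i j; rewrite mxE ord1 [RHS]mxE; have /negbFE/eqP := v0 i.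
rewrite v0' in e1.
pose Q1 : 'M_(1 + n) := block_mx 1%:M (- map_mx (fun p => p %/ a) u) 0 1%:M.
have uQ1 : Q1 \in unitmx by rewrite unitmxE det_ublock !det1 mulr1 unitr1.
have e2 : P1 *m A *m Q1 = block_mx a%:M (map_mx (fun p => p %% a) u) 0 B1.
  rewrite e1 mulmx_block !mulmx1 !mul0mx !mulmx0 !addr0 add0r; congr block_mx.
  apply/matrixP=> i j; rewrite mulmxN mul_scalar_mx !mxE mulrC addrC.
  by rewrite {1}(divp_eq (A (lshift m i) (rshift 1 j)) a) addrAC subrr add0r.
have [j uj|u0] := pickP (fun j => u 0 j %% a != 0).
  have e3 : (P1 *m A *m (Q1 *m tperm_mx (o n) (rshift 1 j))) (o m) (o n) = u 0 j %% a.
    by rewrite mulmxA e2 -xcolE mxE tpermL block_mxEur mxE.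
  apply: (step P1 (Q1 *m tperm_mx (o n) (rshift 1 j))); rewrite ?e3 //.
    by rewrite unitmx_mul unitmx_perm uQ1.
  by rewrite ltn_modp.
exists P1, Q1, a, B1; split=> //; rewrite e2; congr block_mx.
by apply/matrixP=> i j; rewrite mxE ord1 [RHS]mxE; have /negbFE/eqP := u0 j.
Qed.

Definition rect_diag m n (d : seq {poly F}) : 'M[{poly F}]_(m, n) :=
  \matrix_(i, j) (d`_i *+ (i == j :> nat)).

Lemma diagonalize m n (A : 'M[{poly F}]_(m, n)) :
  exists (P : 'M[{poly F}]_m) (Q : 'M[{poly F}]_n) (d : seq {poly F}),
  [/\ P \in unitmx, Q \in unitmx, (size d <= minn m n)%N, 0 \notin d
    & P *m A *m Q = rect_diag m n d].
Proof.
have z m' n' (A' : 'M[{poly F}]_(m', n')) : A' = 0 -> 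
  exists (P : 'M[{poly F}]_m') (Q : 'M[{poly F}]_n') (d : seq {poly F}),
  [/\ P \in unitmx, Q \in unitmx, (size d <= minn m' n')%N, 0 \notin d
    & P *m A' *m Q = rect_diag m' n' d].
  move=> ->; exists 1%:M, 1%:M, [::]; rewrite !unitmx1 mul1mx mulmx1; split=> //.
  by apply/matrixP=> i j; rewrite !mxE nth_nil mul0rn.
elim: m n A => [|m IH] [|n] A; try by apply: z; rewrite ?(flatmx0 A) ?(thinmx0 A).
have [/eqP|/matrix0Pn[i [j Aij]]] := boolP (A == 0); first exact: z.
pose T : 'M_(1 + m, 1 + n) := tperm_mx 0 i *m A *m tperm_mx 0 j.
have T0 : T (o m) (o n) != 0.
  have hp p : o p = 0 :> 'I_(1 + p) by apply/val_inj.
  by rewrite !hp /T -xrowE -xcolE mxE mxE !tpermL.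
have [P [Q [a [B [uP uQ a0 e]]]]] := @clear_first_row_col m n T T0.
have [P' [Q' [d [uP' uQ' sd d0 e']]]] := IH n B.
have ub k (X : 'M[{poly F}]_k) : X \in unitmx ->
    (block_mx 1%:M 0 0 X : 'M_(1 + k)) \in unitmx.
  by move=> uX; rewrite unitmxE det_ublock det1 mul1r -unitmxE.
exists (block_mx 1%:M 0 0 P' *m P *m tperm_mx 0 i),
  (tperm_mx 0 j *m Q *m block_mx 1%:M 0 0 Q'), (a :: d); split.
- by rewrite !unitmx_mul unitmx_perm uP ub.
- by rewrite !unitmx_mul unitmx_perm uQ ub.
- by rewrite minnSS.
- by rewrite inE negb_or eq_sym a0.
have -> : block_mx 1%:M 0 0 P' *m P *m tperm_mx 0 i *m A *m
  (tperm_mx 0 j *m Q *m block_mx 1%:M 0 0 Q') =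
  block_mx 1%:M 0 0 P' *m (P *m T *m Q) *m block_mx 1%:M 0 0 Q'.
  by rewrite /T !mulmxA.
rewrite e !mulmx_block !(mulmx0, mul0mx, addr0, add0r, mul1mx, mulmx1) e'.
apply/matrixP=> k l; rewrite [RHS]mxE.
case: (@split_ordP 1 m k) => k' ->; case: (@split_ordP 1 n l) => l' ->.
- by apply: etrans (block_mxEul _ _ _ _ _ _) _; rewrite !ord1 mxE.
- by apply: etrans (block_mxEur _ _ _ _ _ _) _; rewrite mxE ord1.
- by apply: etrans (block_mxEdl _ _ _ _ _ _) _; rewrite mxE ord1.
by apply: etrans (block_mxEdr _ _ _ _ _ _) _; rewrite mxE.
Qed.

(** The rank is read off through any embedding phi of the polynomial ring in a
    field, so that matrices over the two charts can be compared in F(t). *)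
Lemma mxrank_block_unit (K : fieldType) (phi : {rmorphism {poly F} -> K}) r s
    (P A Q : 'M[{poly F}]_(r + s)) (e : 'M[{poly F}]_r) :
  injective phi -> P \in unitmx -> Q \in unitmx -> \det e != 0 ->
  P *m A *m Q = block_mx e 0 0 0 -> \rank (map_mx phi A) = r.
Proof.
move=> phi_inj uP uQ de eA.
have ue : map_mx phi e \in unitmx.
  rewrite unitmxE det_map_mx unitfE -(rmorph0 phi); apply: contra de => /eqP/phi_inj->.
  by [].
rewrite -(mxrankMfree _ (B := map_mx phi Q)) ?row_free_unit ?map_unitmx //.
rewrite -(eqmxMfull _ (A := map_mx phi P)) ?row_full_unit ?map_unitmx //.
rewrite -!map_mxM /= mulmxA eA map_block_mx !map_mx0.
by rewrite rank_diag_block_mx mxrank0 addn0 mxrank_unit.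
Qed.

(** The size of the diagonal block is the rank of A; the second summand of n is
    kept as a separate variable s so that n can be replaced by r + s. *)
Lemma diagonalize_block n (A : 'M[{poly F}]_n) :
  exists (P Q : 'M[{poly F}]_n) (r : nat), [/\ P \in unitmx, Q \in unitmx,
   (r <= n)%N, forall (K : fieldType) (phi : {rmorphism {poly F} -> K}),
     injective phi -> \rank (map_mx phi A) = r &
   forall s (E : n = (r + s)%N), exists2 e : 'M[{poly F}]_r, \det e != 0 &
     castmx (E, E) (P *m A *m Q) = block_mx e 0 0 0].
Proof.
have [P [Q [d [uP uQ sd d0 e]]]] := diagonalize A.
have dn : (size d <= n)%N by rewrite -[n]minnn.
suff blk s (E : n = (size d + s)%N) : exists2 e' : 'M[{poly F}]_(size d),
    \det e' != 0 & castmx (E, E) (P *m A *m Q) = block_mx e' 0 0 0.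
  exists P, Q, (size d); split=> // K phi phi_inj.
  have [s E] : exists s, n = (size d + s)%N by exists (n - size d)%N; lia.
  subst n.
  have [e' de'] := blk s erefl; rewrite castmx_id.
  exact: mxrank_block_unit.
exists (diag_mx (\row_i d`_i)).
  rewrite det_diag prodf_seq_neq0; apply/allP => i _; rewrite mxE /=.
  by apply: contraNneq d0 => <-; rewrite mem_nth.
rewrite e; apply/matrixP=> k l; rewrite castmxE [LHS]mxE /=.
case: (split_ordP k) => k' -> /=; case: (split_ordP l) => l' -> /=.
- by rewrite block_mxEul !mxE.
- rewrite block_mxEur mxE; case: eqP => // h; have := ltn_ord k'; rewrite /= in h; lia.
- by rewrite block_mxEdl mxE nth_default ?mul0rn //= leq_addr.
by rewrite block_mxEdr mxE nth_default ?mul0rn //= leq_addr.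
Qed.
End diag.

(** * Coherent systems in coordinates *)

Notation constmx := (map_mx (@polyC _)).

Section frames.
Variable F : closedFieldType.

Lemma lincombE n k (B0 B1 : 'M[{poly F}]_(n, k)) (a : 'I_k -> F) :
  lincomb (fun j => (col j B0, col j B1)) a =
  (B0 *m constmx (\col_j a j), B1 *m constmx (\col_j a j)).
Proof.
rewrite /lincomb [LHS]surjective_pairing.
rewrite (big_morph (@fst _ _) (id1 := 0) (op1 := +%R)) //.
rewrite (big_morph (@snd _ _) (id1 := 0) (op1 := +%R)) //=.
by congr pair; apply/matrixP=> i j; rewrite ord1 summxE mxE; apply: eq_bigr => l _;
  rewrite !mxE mulrC.
Qed.

Definition sec_span n k (B0 B1 : 'M[{poly F}]_(n, k)) : set (vec2 F n) :=
  [set (B0 *m constmx c, B1 *m constmx c) | c in [set: 'cV[F]_k]].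

(** The columns of B0 and B1 are the local expressions of sections of E.  Linear
    independence is imposed on the first chart only, as a section is determined
    by its expression there. *)
Definition is_frame n d (E : vbundle F n d) k (B0 B1 : 'M[{poly F}]_(n, k)) :=
  map_mx chart0 B0 = trans E *m map_mx chart1 B1 /\
  forall c : 'cV[F]_k, B0 *m constmx c = 0 -> c = 0.

Lemma map_chart_const (m n : nat) (A : 'M[F]_(m, n)) :
  map_mx chart1 (constmx A) = map_mx chart0 (constmx A).
Proof. by apply/matrixP=> i j; rewrite !mxE chart1C. Qed.

Lemma map_inj_mx (phi : {rmorphism {poly F} -> funfield F}) m n :
  injective phi -> injective (fun A : 'M_(m, n) => map_mx phi A).
Proof.
move=> h A B e; apply/matrixP=> i j; apply: h.
by have := congr1 (fun A : 'M_(m, n) => A i j) e; rewrite !mxE.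
Qed.

Lemma trans_unit n d (E : vbundle F n d) : trans E \in unitmx.
Proof.
have [c c0 e] := trans_det E.
by rewrite unitmxE e unitfE mulf_neq0 ?coord_z_neq0 // chart0_eq0 polyC_eq0.
Qed.

Lemma frame_glue n d (E : vbundle F n d) k (B0 B1 : 'M[{poly F}]_(n, k)) m
    (C0 : 'M_(k, m)) (C1 : 'M_(k, m)) :
  is_frame E B0 B1 -> map_mx chart0 C0 = map_mx chart1 C1 ->
  map_mx chart0 (B0 *m C0) = trans E *m map_mx chart1 (B1 *m C1).
Proof. by move=> [e _] c; rewrite !map_mxM /= e c mulmxA. Qed.

Lemma cohsys_of_frame n d (E : vbundle F n d) k (B0 B1 : 'M[{poly F}]_(n, k)) :
  is_frame E B0 B1 -> exists X : cohsys F n d k,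
    bundle X = E /\
    secs X = sec_span B0 B1.
Proof.
move=> fr.
set V := sec_span B0 B1.
have VH : V `<=` H0 E.
  move=> _ [c _ <-] /=; apply: (frame_glue fr).
  by rewrite map_chart_const.
have Vd : subspace_of_dim k V.
  exists (fun j => (col j B0, col j B1)); split.
    move=> a; rewrite lincombE => -[/fr.2 e _] i.
    by have := congr1 (fun c : 'cV_k => c i 0) e; rewrite !mxE.
  apply/seteqP; split=> [_ [c _ <-]|_ [a _ <-]].
    exists (fun j => c j 0) => //; rewrite lincombE.
    suff -> : \col_j c j 0 = c by [].
    by apply/matrixP=> i j; rewrite mxE ord1.
  by exists (\col_j a j) => //; rewrite lincombE.
by exists (CohSys VH Vd).
Qed.

Lemma frame_of_cohsys n d k (X : cohsys F n d k) :
  exists B0 B1 : 'M[{poly F}]_(n, k),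
  is_frame (bundle X) B0 B1 /\
  secs X = sec_span B0 B1.
Proof.
have [b [bi bV]] := secs_dim X.
exists (\matrix_(i, j) (b j).1 i 0), (\matrix_(i, j) (b j).2 i 0).
set B0 := \matrix_(i, j) _; set B1 := \matrix_(i, j) _.
have eb : b = fun j => (col j B0, col j B1).
  apply: boolp.funext => j; rewrite [LHS]surjective_pairing.
  by congr pair; apply/matrixP=> i l; rewrite !mxE ord1.
have eV : secs X = sec_span B0 B1.
  rewrite bV eb; apply/seteqP; split=> [_ [a _ <-]|_ [c _ <-]].
    by exists (\col_j a j) => //; rewrite lincombE.
  exists (fun j => c j 0) => //; rewrite lincombE.
  suff -> : \col_j c j 0 = c by [].
  by apply/matrixP=> i j; rewrite mxE ord1.
have fe : map_mx chart0 B0 = trans (bundle X) *m map_mx chart1 B1.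
  apply/matrixP=> i j.
  have mj : secs X (b j).
    rewrite eV; exists (delta_mx j 0) => //; rewrite map_delta_mx -!colE eb //.
  have := congr1 (fun c : 'cV_n => c i 0) (secs_H0 mj); rewrite [LHS]mxE eb /= !mxE => ->.
  by apply: eq_bigr => l _; rewrite !mxE.
split=> //; split=> // c c0.
have c1 : B1 *m constmx c = 0.
  apply: (map_inj_mx (@chart1_inj F)); apply: (can_inj (mulKmx (trans_unit (bundle X)))).
  by rewrite map_mxM mulmxA -fe map_chart_const -map_mxM c0 !map_mx0 mulmx0.
have := bi (fun j => c j 0); rewrite eb lincombE.
have -> : \col_j c j 0 = c by apply/matrixP=> i j; rewrite mxE ord1.
rewrite c0 c1 => /(_ erefl) h; apply/matrixP=> i j; rewrite ord1 h mxE //.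
Qed.

(** How stability is used: u = (u0, u1) embeds E' in E, w = (w0, w1) is a left
    inverse chart by chart, and M describes the subspace of V generated by its
    columns.  The last two hypotheses say that this subspace consists of sections
    of E'. *)
Lemma stable_frame_slope (R : realType) (alpha : R) n d k (X : cohsys F n d k)
    (B0 B1 : 'M[{poly F}]_(n, k)) n' d' k' (E' : vbundle F n' d')
    (u0 u1 : 'M[{poly F}]_(n, n')) (w0 w1 : 'M[{poly F}]_(n', n))
    (M : 'M[F]_(k, k')) (M' : 'M[F]_(k', k)) :
  stable alpha X ->
  is_frame (bundle X) B0 B1 ->
  secs X = sec_span B0 B1 ->
  (0 < n' < n)%N ->
  w0 *m u0 = 1%:M -> w1 *m u1 = 1%:M -> M' *m M = 1%:M ->
  map_mx chart0 u0 *m trans E' = trans (bundle X) *m map_mx chart1 u1 ->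
  u0 *m (w0 *m (B0 *m constmx M)) = B0 *m constmx M ->
  u1 *m (w1 *m (B1 *m constmx M)) = B1 *m constmx M ->
  slope alpha n' d' k' < slope alpha n d k.
Proof.
move=> st fr eV /andP[n0 nn] wu0 wu1 MM eu e0 e1.
set C0 := w0 *m (B0 *m constmx M) in e0.
set C1 := w1 *m (B1 *m constmx M) in e1.
have fr' : is_frame E' C0 C1.
  split.
    have wu : map_mx chart0 w0 *m map_mx chart0 u0 = 1%:M.
      by rewrite -map_mxM wu0 map_mx1.
    have := congr1 (mulmx (map_mx chart0 w0)) (frame_glue fr (esym (map_chart_const M))).
    rewrite -e0 -e1 !map_mxM /= (mulmxA (trans _)) -eu -mulmxA !(mulmxA (map_mx chart0 w0)).
    by rewrite wu !mul1mx.
  move=> c c0; have : constmx (M *m c) = 0 :> 'cV[{poly F}]_k.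
    rewrite (fr.2 (M *m c)) ?map_mx0 // map_mxM mulmxA -e0 -mulmxA c0 mulmx0 //.
  move=> h; have Mc : M *m c = 0.
    apply/matrixP=> i j; have := congr1 (fun c : 'cV_k => c i j) h.
    by rewrite !mxE => /eqP; rewrite polyC_eq0 => /eqP.
  by rewrite -[c]mul1mx -MM -mulmxA Mc mulmx0.
have [X' [eE eV']] := cohsys_of_frame fr'.
move: eu; rewrite -eE => eu.
apply: (st n' d' k' X' (BHom eu)); split.
  split=> //.
    move=> a; have rk (w : 'M[{poly F}]_(n', n)) (u : 'M_(n, n')) : w *m u = 1%:M ->
        \rank (map_mx (fun p : {poly F} => p.[a]) u) = n'.
      move=> wu; apply/eqP; rewrite eqn_leq rank_leq_col /=.
      have := congr1 (map_mx (horner_eval a)) wu; rewrite map_mxM map_mx1 => h.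
      by rewrite -[X in (X <= _)%N](mxrank1 F n') -h mxrankM_maxr.
    by split; apply: rk; [exact: wu0 | exact: wu1].
  rewrite eV' eV => _ [_ [c _ <-] <-]; rewrite /bhom_sec /=.
  exists (M *m c) => //; congr pair.
    by rewrite map_mxM mulmxA -e0 mulmxA.
  by rewrite map_mxM mulmxA -e1 mulmxA.
move=> [[h' [hh _ _ _]] _]; move: nn; rewrite ltnNge; apply/negP/negPn.
exact: mulmx1_min hh.
Qed.
End frames.

(** * Stable coherent systems are simple *)

Section simple.
Variable F : closedFieldType.

(** The last s columns of Q are a frame of the kernel of A, with the last s rows
    of Q^-1 as coordinates. *)
Lemma block_ker r s p (A P Q : 'M[{poly F}]_(r + s)) (e : 'M_r)
    (Y : 'M_(r + s, p)) :
  P \in unitmx -> Q \in unitmx -> \det e != 0 -> P *m A *m Q = block_mx e 0 0 0 ->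
  A *m Y = 0 -> rsubmx Q *m (dsubmx (invmx Q) *m Y) = Y.
Proof.
move=> uP uQ de eA AY; pose Z := invmx Q *m Y.
have eY : Y = Q *m Z by rewrite /Z mulKVmx.
have: P *m A *m Q *m Z = 0 by rewrite -mulmxA -eY -mulmxA AY mulmx0.
rewrite eA -[Z]vsubmxK mul_block_col !mul0mx !addr0 -[X in _ = X](@col_mx0 _ r s).
case/eq_col_mx => eZ _; have uZ : usubmx Z = 0.
  apply/matrixP=> i j; have := congr1 (fun W => \adj e *m W) eZ.
  rewrite mulmxA mul_adj_mx mul_scalar_mx mulmx0 => /(congr1 (fun W : 'M_(r, p) => W i j)).
  by rewrite !mxE => /eqP; rewrite mulf_eq0 (negPf de) /= => /eqP.
rewrite mul_dsub_mx -/Z [RHS]eY -{2}[Q]hsubmxK -{2}[Z]vsubmxK mul_row_col uZ.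
by rewrite mulmx0 add0r.
Qed.

(** The first r columns of P^-1 are a frame of the saturation of the image of A,
    with the first r rows of P as coordinates. *)
Lemma block_im r s p (A P Q : 'M[{poly F}]_(r + s)) (e : 'M_r)
    (Y : 'M_(r + s, p)) :
  P \in unitmx -> Q \in unitmx -> P *m A *m Q = block_mx e 0 0 0 ->
  lsubmx (invmx P) *m (usubmx P *m (A *m Y)) = A *m Y.
Proof.
move=> uP uQ eA.
have eY : P *m (A *m Y) = block_mx e 0 0 0 *m (invmx Q *m Y).
  by rewrite -eA -!mulmxA mulKVmx // mulmxA.
rewrite -[RHS](mulKmx uP) mul_usub_mx eY -[_ *m Y]vsubmxK.
rewrite mul_block_col !mul0mx !addr0 col_mxKu.
by rewrite -{2}[invmx P]hsubmxK mul_row_col mulmx0 addr0.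
Qed.

Lemma sub_inverses r s (A B : 'M[{poly F}]_(r + s)) : A *m B = 1%:M ->
  usubmx A *m lsubmx B = 1%:M /\ dsubmx A *m rsubmx B = 1%:M.
Proof.
rewrite -{1}[A]vsubmxK -{1}[B]hsubmxK mul_col_row scalar_mx_block.
by case/eq_block_mx.
Qed.

Lemma change_frame n d (E : vbundle F n d) (U V : 'M[{poly F}]_n) :
  U \in unitmx -> V \in unitmx -> exists E' : vbundle F n d,
    trans E' = map_mx chart0 U *m trans E *m map_mx chart1 V.
Proof.
move=> uU uV; set g := _ *m _ *m _.
have lg i j : laurent (g i j).
  apply: laurent_mulmx i j; last by move=> i j; rewrite mxE; apply: laurent_chart1.
  apply: laurent_mulmx; last exact: trans_laurent.
  by move=> i j; rewrite mxE; apply: laurent_chart0.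
have dg : exists2 c : F, c != 0 & \det g = chart0 c%:P * coord ^ d.
  have [c c0 dE] := trans_det E; have [u u0 dU] := det_unit_const uU.
  have [v v0 dV] := det_unit_const uV.
  exists (u * c * v); first by rewrite !mulf_neq0.
  rewrite !det_mulmx dE !det_map_mx dU dV /= chart1C !polyCM !rmorphM /=.
  by rewrite -!mulrA [coord ^ d * _]mulrC.
by exists (VBundle lg dg).
Qed.

Lemma coord_mono_inj (c c' : F) (a b : int) : c != 0 -> c' != 0 ->
  chart0 c%:P * coord ^ a = chart0 c'%:P * coord ^ b -> a = b.
Proof.
have h (x y : F) (i j : int) : x != 0 -> 
    chart0 x%:P * coord ^ i = chart0 y%:P * coord ^ j -> i <= j.
  move=> x0 e; rewrite leNgt; apply: contra x0 => ij.
  have e2 : chart0 x%:P = coord ^ (j - i) * chart1 y%:P.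
    apply: (mulIf (coord_z_neq0 F i)); rewrite e chart1C coord_zD mulrAC.
    by rewrite -[_ * _ * coord ^ i]mulrA -coord_zD addNr expr0z mulr1 mulrC.
  have := chart_glue_coef e2 (i := 0%N); rewrite coefC /= => ->//.
  by rewrite subr_lt0.
by move=> c0 c0' e; apply/eqP; rewrite eq_le (h _ _ _ _ c0 e) (h _ _ _ _ c0' (esym e)).
Qed.

(** The determinants of the diagonal blocks are Laurent polynomials whose product
    is a unit, so each of them is a unit and the blocks define vector bundles. *)
Lemma triangular_bundle r s d (E : vbundle F (r + s) d) :
  ursubmx (trans E) = 0 \/ dlsubmx (trans E) = 0 ->
  exists (a b : int) (E1 : vbundle F r a) (E2 : vbundle F s b),
  [/\ a + b = d, trans E1 = ulsubmx (trans E) & trans E2 = drsubmx (trans E)].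
Proof.
move=> tri; set g1 := ulsubmx _; set g2 := drsubmx _.
have l1 i j : laurent (g1 i j) by rewrite !mxE; apply: trans_laurent.
have l2 i j : laurent (g2 i j) by rewrite !mxE; apply: trans_laurent.
have [c c0 dE] := trans_det E.
have dg : \det g1 * \det g2 = chart0 c%:P * coord ^ d.
  rewrite -dE -[trans E]submxK.
  by case: tri => ->; rewrite ?det_lblock ?det_ublock.
have [a [c1 [c10 e1]]] := laurent_unit (laurent_det l1) (laurent_det l2) c0 dg.
rewrite mulrC in dg.
have [b [c2 [c20 e2]]] := laurent_unit (laurent_det l2) (laurent_det l1) c0 dg.
have d1 : exists2 c : F, c != 0 & \det g1 = chart0 c%:P * coord ^ a by exists c1.
have d2 : exists2 c : F, c != 0 & \det g2 = chart0 c%:P * coord ^ b by exists c2.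
exists a, b, (VBundle l1 d1), (VBundle l2 d2); split=> //.
apply: (@coord_mono_inj (c1 * c2) c); rewrite ?mulf_neq0 //.
by rewrite -dg e1 e2 coord_zD polyCM rmorphM /= [RHS]mulrACA; congr (_ * _); rewrite mulrC.
Qed.

(** A generically injective map E -> E' of bundles of the same rank has as
    determinant a nonzero section of O(b - a). *)
Lemma degree_le r a b (E : vbundle F r a) (E' : vbundle F r b)
  (f0 f1 : 'M[{poly F}]_r) : \det f0 != 0 ->
  map_mx chart0 f0 *m trans E = trans E' *m map_mx chart1 f1 -> a <= b.
Proof.
move=> f00 /(congr1 determinant); rewrite !det_mulmx !det_map_mx /=.
have [c c0 ->] := trans_det E; have [c' c0' ->] := trans_det E'.
move=> e; rewrite leNgt; apply/negP => ab.
have e2 : chart0 (\det f0 * c%:P) = coord ^ (b - a) * chart1 (c'%:P * \det f1).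
  apply: (mulIf (coord_z_neq0 F a)); rewrite !rmorphM /= chart1C.
  rewrite -mulrA e [RHS]mulrAC -coord_zD subrK; ring.
have z : \det f0 * c%:P = 0.
  apply/polyP => i; rewrite coef0; apply: (chart_glue_coef e2).
  by move: ab; lia.
by move/eqP: z; rewrite mulf_eq0 (negPf f00) polyC_eq0 (negPf c0).
Qed.

(** In the frames Q0, Q1 of the source and P0^-1, P1^-1 of the target the
    endomorphism is e0, e1 on the first r coordinates and 0 elsewhere, so the
    transition matrix H of the source is lower triangular, with the kernel as
    last block, and the transition matrix H' of the target is upper triangular,
    with the saturated image as first block.  The endomorphism induces an
    injection of the quotient by the kernel into the saturated image, which
    compares the degrees. *)
Lemma no_block_endo (R : realType) (alpha : R) r s d k
    (X : cohsys F (r + s) d k) (B0 B1 : 'M[{poly F}]_(r + s, k))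
    (h0 h1 P0 Q0 P1 Q1 : 'M[{poly F}]_(r + s)) (e0 e1 : 'M[{poly F}]_r)
    (M : 'M[F]_k) :
  stable alpha X -> is_frame (bundle X) B0 B1 ->
  secs X = sec_span B0 B1 ->
  map_mx chart0 h0 *m trans (bundle X) = trans (bundle X) *m map_mx chart1 h1 ->
  h0 *m B0 = B0 *m constmx M ->
  P0 \in unitmx -> Q0 \in unitmx -> P1 \in unitmx -> Q1 \in unitmx ->
  \det e0 != 0 -> \det e1 != 0 ->
  P0 *m h0 *m Q0 = block_mx e0 0 0 0 -> P1 *m h1 *m Q1 = block_mx e1 0 0 0 ->
  (0 < r)%N -> (0 < s)%N -> False.
Proof.
move=> st fr eV eh hM0 uP0 uQ0 uP1 uQ1 de0 de1 D0 D1 r0 s0.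
set E := bundle X in fr eh.
have hM1 : h1 *m B1 = B1 *m constmx M.
  apply: (map_inj_mx (@chart1_inj F)); apply: (can_inj (mulKmx (trans_unit E))).
  have e := frame_glue fr (esym (map_chart_const M)); rewrite -e -hM0 !map_mxM /= fr.1.
  by rewrite !mulmxA eh.
have [H eH] := change_frame E (U := invmx Q0) (V := Q1) (etrans (unitmx_inv _) uQ0) uQ1.
have [H' eH'] := change_frame E (U := P0) (V := invmx P1) uP0 (etrans (unitmx_inv _) uP1).
have eD : block_mx (map_mx chart0 e0) 0 0 0 *m trans H =
          trans H' *m block_mx (map_mx chart1 e1) 0 0 0.
  have <- : map_mx chart0 (P0 *m h0 *m Q0) = block_mx (map_mx chart0 e0) 0 0 0.
    by rewrite D0 map_block_mx !map_mx0.
  have <- : map_mx chart1 (P1 *m h1 *m Q1) = block_mx (map_mx chart1 e1) 0 0 0.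
    by rewrite D1 map_block_mx !map_mx0.
  rewrite eH eH' !map_mxM /= !mulmxA.
  have cQ : map_mx chart0 Q0 *m map_mx chart0 (invmx Q0) = 1%:M.
    by rewrite -map_mxM mulmxV // map_mx1.
  have cP : map_mx chart1 (invmx P1) *m map_mx chart1 P1 = 1%:M.
    by rewrite -map_mxM mulVmx // map_mx1.
  rewrite -(mulmxA _ (map_mx chart0 Q0)) cQ mulmx1.
  rewrite -(mulmxA _ (map_mx chart1 (invmx P1))) cP mulmx1.
  by rewrite -(mulmxA (map_mx chart0 P0)) eh !mulmxA.
move: eD; rewrite -[trans H]submxK -[trans H']submxK !mulmx_block.
rewrite !(mul0mx, mulmx0, addr0, add0r); case/eq_block_mx => eul /esym eur edl _.
have ue0 : map_mx chart0 e0 \in unitmx.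
  by rewrite unitmxE det_map_mx unitfE chart0_eq0.
have ue1 : map_mx chart1 e1 \in unitmx.
  rewrite unitmxE det_map_mx unitfE -(rmorph0 chart1).
  by apply: contra de1 => /eqP/chart1_inj->.
have ur : ursubmx (trans H) = 0 by apply: (can_inj (mulKmx ue0)); rewrite mulmx0.
have dl : dlsubmx (trans H') = 0 by apply: (can_inj (mulmxK ue1)); rewrite mul0mx.
have [a [b [E1 [E2 [ab eE1 eE2]]]]] := triangular_bundle (or_introl ur).
have [a' [b' [E1' [E2' [ab' eE1' eE2']]]]] := triangular_bundle (or_intror dl).
have le_a : a <= a'.
  by apply: (degree_le (E := E1) (E' := E1') de0 (f1 := e1)); rewrite eE1 eE1'.
have [w0 w0'] := sub_inverses (mulVmx uQ0).
have [w1 w1'] := sub_inverses (mulVmx uQ1).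
have glueK : map_mx chart0 (rsubmx Q0) *m trans E2 = trans E *m map_mx chart1 (rsubmx Q1).
  rewrite eE2; have := congr1 (mulmx (map_mx chart0 Q0)) eH.
  rewrite !mulmxA -map_mxM mulmxV // map_mx1 mul1mx.
  rewrite -[in LHS](submxK (trans H)) ur -{1}[Q0]hsubmxK -{1}[Q1]hsubmxK.
  rewrite !map_row_mx mul_row_block mul_mx_row mulmx0 add0r.
  by case/eq_row_mx.
(* The subsystem given by the kernel carries ker M, where M is the matrix of
   the endomorphism on V. *)
pose MK : 'M_(k, _) := (row_base (kermx M^T))^T.
have MMK : M *m MK = 0.
  apply: trmx_inj; rewrite trmx_mul trmxK trmx0.
  by apply/sub_kermxP; rewrite eq_row_base.
have [MK' eMK] : exists MK', MK' *m MK = 1%:M.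
  have /row_freeP[W eW] := row_base_free (kermx M^T).
  by exists W^T; rewrite -trmx_mul eW trmx1.
have cK (B h : 'M_(r + s, _)) : h *m B = B *m constmx M -> h *m (B *m constmx MK) = 0.
  by move=> e; rewrite mulmxA e -mulmxA -map_mxM MMK map_mx0 mulmx0.
have n2 : (0 < s < r + s)%N by lia.
have slK := stable_frame_slope st fr eV n2 w0' w1' eMK glueK
  (block_ker uP0 uQ0 de0 D0 (cK _ _ hM0)) (block_ker uP1 uQ1 de1 D1 (cK _ _ hM1)).
have [v0 v0'] := sub_inverses (mulmxV uP0).
have [v1 v1'] := sub_inverses (mulmxV uP1).
have glueI : map_mx chart0 (lsubmx (invmx P0)) *m trans E1' =
    trans E *m map_mx chart1 (lsubmx (invmx P1)).
  rewrite eE1'; have := congr1 (mulmx (map_mx chart0 (invmx P0))) eH'.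
  rewrite !mulmxA -map_mxM mulVmx // map_mx1 mul1mx.
  rewrite -[in LHS](submxK (trans H')) dl -{1}[invmx P0]hsubmxK -{1}[invmx P1]hsubmxK.
  rewrite !map_row_mx mul_row_block mul_mx_row mulmx0 addr0.
  by case/eq_row_mx.
have [W eW] : exists W, row_base M *m W = 1%:M by apply/row_freeP/row_base_free.
(* The subsystem given by the image carries the column space of M; as
   col_base M = M W, its members are images of sections in V. *)
have eI : col_base M = M *m W by have := congr1 (mulmx^~ W) (mulmx_base M); rewrite -mulmxA eW mulmx1.
have [MI' eMI] : exists MI', MI' *m col_base M = 1%:M by apply/row_fullP/col_base_full.
have cI (B h : 'M_(r + s, _)) : h *m B = B *m constmx M ->
    B *m constmx (col_base M) = h *m (B *m constmx W).
  by move=> e; rewrite eI map_mxM !mulmxA e.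
have n1 : (0 < r < r + s)%N by lia.
have slI : slope alpha r a' (\rank M) < slope alpha (r + s) d k.
  apply: (stable_frame_slope st fr eV n1 v0 v1 eMI glueI).
    by rewrite (cI _ _ hM0); apply: block_im uP0 uQ0 D0.
  by rewrite (cI _ _ hM1); apply: block_im uP1 uQ1 D1.
rewrite mxrank_ker mxrank_tr in slK.
have lek : (\rank M <= k)%N := rank_leq_row M.
have sR : 0 < s%:R :> R by rewrite ltr0n.
have rR : 0 < r%:R :> R by rewrite ltr0n.
have nR : 0 < (r + s)%:R :> R by rewrite natrD addr_gt0.
have sl (m : nat) (x : int) (l : nat) : slope alpha m x l = (x%:~R + alpha * l%:R) / m%:R.
  by rewrite /slope mulrDl mulrA.
move: slK slI; rewrite !sl.
set mu := (_ + _) / (r + s)%:R; rewrite !ltr_pdivrMr // => slK slI.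
have emu : mu * (r + s)%:R = d%:~R + alpha * k%:R by rewrite /mu divfK ?gt_eqF.
(* Both slopes lie below mu, so their average weighted by the ranks does too;
   but that average is at least mu because a <= a'. *)
have lt2 := ltrD slK slI; rewrite -mulrDr addrC -natrD in lt2.
rewrite [(s + r)%N]addnC emu -ab natrB // in lt2.
have le2 : a%:~R <= a'%:~R :> R by rewrite ler_int.
rewrite intrD in lt2; clear - le2 lt2; lra.
Qed.

(** The transition matrix conjugates f0 and f1 over F(t), so both have the same
    rank r, and 0 < r < n because f0 is nonzero and singular. *)
Lemma no_singular_endo (R : realType) (alpha : R) n d k
    (X : cohsys F n d k) (B0 B1 : 'M[{poly F}]_(n, k))
    (f0 f1 : 'M[{poly F}]_n) (M : 'M[F]_k) :
  stable alpha X -> is_frame (bundle X) B0 B1 ->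
  secs X = sec_span B0 B1 ->
  map_mx chart0 f0 *m trans (bundle X) = trans (bundle X) *m map_mx chart1 f1 ->
  f0 *m B0 = B0 *m constmx M -> \det f0 = 0 -> f0 != 0 -> False.
Proof.
move=> st fr eV ef fM df0 nz.
have [P0 [Q0 [r [uP0 uQ0 rn rk0 D0]]]] := diagonalize_block f0.
have [P1 [Q1 [r' [uP1 uQ1 rn' rk1 D1]]]] := diagonalize_block f1.
have rr : r' = r.
  rewrite -(rk1 _ chart1 (@chart1_inj F)) -(rk0 _ chart0 (@chart0_inj F)).
  have uE := trans_unit (bundle X).
  rewrite -(mxrankMfree (map_mx chart0 f0) (B := trans (bundle X))) ?row_free_unit // ef.
  by rewrite (eqmxMfull _ (A := trans (bundle X))) ?row_full_unit.
have r0 : (0 < r)%N.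
  rewrite lt0n -(rk0 _ chart0 (@chart0_inj F)) mxrank_eq0; apply: contra nz => /eqP e.
  by apply/eqP/(map_inj_mx (@chart0_inj F)); rewrite e map_mx0.
have rlt : (r < n)%N.
  rewrite ltn_neqAle rn andbT; apply/negP => /eqP e.
  have : map_mx chart0 f0 \in unitmx.
    by rewrite -row_free_unit /row_free (rk0 _ chart0 (@chart0_inj F)) e.
  by rewrite unitmxE det_map_mx df0 rmorph0 unitr0.
subst r'; have [s E] : exists s, n = (r + s)%N by exists (n - r)%N; lia.
have s0 : (0 < s)%N by lia.
clear rlt rn rn'; subst n.
move: D0 D1 => /(_ s erefl)[e0 de0 + ] /(_ s erefl)[e1 de1].
rewrite !castmx_id => D0 D1.
exact: (no_block_endo st fr eV ef fM uP0 uQ0 uP1 uQ1 de0 de1 D0 D1).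
Qed.

Theorem stable_simple (R : realType) (alpha : R) n d k
    (X : cohsys F n d k) (B0 B1 : 'M[{poly F}]_(n, k))
    (h0 h1 : 'M[{poly F}]_n) (M : 'M[F]_k) :
  stable alpha X -> is_frame (bundle X) B0 B1 ->
  secs X = sec_span B0 B1 ->
  map_mx chart0 h0 *m trans (bundle X) = trans (bundle X) *m map_mx chart1 h1 ->
  h0 *m B0 = B0 *m constmx M ->
  exists c : F, h0 = c%:P%:M.
Proof.
move=> st fr eV eh hM.
case: n => [|n] in X B0 B1 h0 h1 st fr eV eh hM *.
  by exists 0; apply/matrixP=> -[].
have [c cr] : exists c, root (char_poly (map_mx (horner_eval 0) h0)) c.
  by apply: closed_rootP; rewrite size_char_poly.
exists c; apply/eqP; rewrite -subr_eq0; apply/negPn/negP => nz.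
set f0 := h0 - _ in nz.
pose f1 := h1 - c%:P%:M.
have ef : map_mx chart0 f0 *m trans (bundle X) = trans (bundle X) *m map_mx chart1 f1.
  rewrite !map_mxB !map_scalar_mx /= mulmxBl mulmxBr eh chart1C.
  by rewrite mul_scalar_mx mul_mx_scalar.
have fM : f0 *m B0 = B0 *m constmx (M - c%:M).
  by rewrite map_mxB map_scalar_mx mulmxBl mulmxBr hM mul_scalar_mx mul_mx_scalar.
have df0 : \det f0 = 0.
  have := congr1 determinant ef; rewrite !det_mulmx mulrC => /(mulfI _).
  have : \det (trans (bundle X)) != 0.
    by have := trans_unit (bundle X); rewrite unitmxE unitfE.
  move=> d0 /(_ d0); rewrite !det_map_mx => /global_function_const[b [eb _]].
  rewrite eb; suff -> : b = 0 by [].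
  rewrite -(hornerC b 0) -eb -[_.[0]]/(horner_eval 0 _) -det_map_mx map_mxB /=.
  rewrite map_scalar_mx /= /horner_eval hornerC; apply/eqP/det0P.
  have := cr; rewrite -eigenvalue_root_char => /eigenvalueP[v ev v0].
  by exists v => //; rewrite mulmxBr mul_mx_scalar ev subrr.
apply: (no_singular_endo (M := M - c%:M) st fr eV ef fM df0 nz).
Qed.

End simple.

(** * The dimension count *)

Lemma linear_kernel_neq0 (K : fieldType) (aT rT : vectType K) (f : aT -> rT) :
  linear f -> (dim rT < dim aT)%N -> exists2 v, v != 0 & f v = 0.
Proof.
move=> lf lt_dim.
pose f' := GRing.isLinear.Build K aT rT *:%R f lf.
pose g : {linear aT -> rT} := HB.pack f f'.
have eg v : linfun g v = f v by rewrite lfunE.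
have := limg_ker_dim (linfun g) fullv; rewrite capfv dimvf => e.
have nz : lker (linfun g) != 0%VS.
  apply: contraTneq lt_dim => k0; rewrite -leqNgt -e k0 dimv0 add0n.
  by rewrite -(dimvf rT) dimvS // subvf.
exists (vpick (lker (linfun g))); first by rewrite vpick0.
by rewrite -eg; apply/eqP; rewrite -memv_ker memv_pick.
Qed.

Lemma card_sigma_ord (I : finType) (e : I -> nat) :
  #|{: {i : I & 'I_(e i)}}| = (\sum_i e i)%N.
Proof.
rewrite card_tagged sumnE big_map big_enum /=.
by apply: eq_bigr => i _; rewrite card_ord.
Qed.

Section count.
Variables (F : closedFieldType) (R : realType) (alpha : R) (n : nat) (d : int) (k : nat).
Variables (X : cohsys F n d k) (B0 B1 : 'M[{poly F}]_(n, k)).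
Variables (a : 'I_n -> int) (P Q : 'M[{poly F}]_n).
Hypotheses (st : stable alpha X) (fr : is_frame (bundle X) B0 B1).
Hypothesis eV :
  secs X = sec_span B0 B1.
Hypotheses (uP : P \in unitmx) (uQ : Q \in unitmx).
Let D : 'M[funfield F]_n := diag_mx (\row_i coord ^ a i).
Hypothesis eE : trans (bundle X) = map_mx chart0 P *m D *m map_mx chart1 Q.

Hypothesis sum_a : \sum_i a i = d.

(** The coordinates in the splitting of E of the basis B0 of V. *)
Let Y := invmx P *m B0.

Lemma split_sections i l (t : nat) : a i < t%:Z -> (Y i l)`_t = 0.
Proof.
apply: (chart_glue_coef (q := (Q *m B1) i l)).
have := fr.1; rewrite eE -mulmxA -map_mxM.
move/(congr1 (mulmx (map_mx chart0 (invmx P)))).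
rewrite !mulmxA -!map_mxM mulVmx // map_mx1 mul1mx mul_diag_mx.
by move/matrixP/(_ i l); rewrite !mxE.
Qed.

(** A matrix with entries f_ij in H^0(O(a_i - a_j)) is an endomorphism of the
    split bundle; conjugating by P and Q gives an endomorphism of E. *)
Lemma split_simple (f : 'M[{poly F}]_n) (M : 'M[F]_k) :
  (forall i j (t : nat), a i - a j < t%:Z -> (f i j)`_t = 0) ->
  f *m Y = Y *m constmx M -> exists c : F, f = c%:P%:M.
Proof.
move=> fa fY.
pose q i j := boolp.cid (glue_chart (@fa i j)).
pose f1 := \matrix_(i, j) sval (q i j).
have ef : map_mx chart0 f *m D = D *m map_mx chart1 f1.
  rewrite mul_diag_mx mul_mx_diag; apply/matrixP=> i j; rewrite !mxE.
  by case: (q i j) => z /= ->; rewrite mulrAC -coord_zD subrK.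
have cP : map_mx chart0 (invmx P) *m map_mx chart0 P = 1%:M.
  by rewrite -map_mxM mulVmx // map_mx1.
have cQ : map_mx chart1 Q *m map_mx chart1 (invmx Q) = 1%:M.
  by rewrite -map_mxM mulmxV // map_mx1.
have [||c ec] := @stable_simple F R alpha n d k X B0 B1 (P *m f *m invmx P)
  (invmx Q *m f1 *m Q) M st fr eV.
- rewrite eE !map_mxM /= !mulmxA -(mulmxA _ _ (map_mx chart0 P)) cP mulmx1.
  rewrite -(mulmxA _ (map_mx chart1 Q)) cQ mulmx1.
  by rewrite -(mulmxA _ _ D) ef !mulmxA.
- by rewrite -!mulmxA fY /Y mulmxA mulKVmx.
exists c; rewrite -[f](mulKmx uP) -[P *m f](mulmxK (etrans (unitmx_inv _) uP)).
by rewrite invmxK ec mul_scalar_mx -scalemxAr mulVmx // scalemx1.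
Qed.

(** If a_i were negative, the projection to O(a_i) would kill V without being a
    scalar. *)
Lemma split_nonneg i : (2 <= n)%N -> 0 <= a i.
Proof.
move=> n2; rewrite leNgt; apply/negP => ai.
have [||c ec] := @split_simple (delta_mx i i) 0.
- move=> i' j' t; rewrite mxE; case: (i' =P i) => [->|_]; last by rewrite coef0.
  case: (j' =P i) => [->|_]; last by rewrite coef0.
  by rewrite subrr coefC; case: t.
- rewrite map_mx0 mulmx0; apply/matrixP=> i' l; rewrite [RHS]mxE mxE.
  rewrite big1 // => j _; rewrite mxE; case: (j =P i) => [->|_]; last first.
    by rewrite andbF mul0r.
  suff -> : Y i l = 0 by rewrite mulr0.
  by apply/polyP=> t; rewrite coef0 split_sections //; lia.
have [j ji] : exists j : 'I_n, j != i.
  have : (0 < #|predC1 i|)%N by rewrite cardC1 card_ord; lia.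
  by case/card_gt0P => j; exists j.
have := congr1 (fun f : 'M_n => f i i) ec; have := congr1 (fun f : 'M_n => f j j) ec.
rewrite !mxE !eqxx (negPf ji) /= !mulr1n => <- /eqP; by rewrite oner_eq0.
Qed.

(** As a_i >= 0, e (i, j) and b i are the dimensions of H^0(O(a_i - a_j)) and
    H^0(O(a_i)); so functions on I are endomorphisms of E, and functions on J are
    linear maps from V to H^0(E). *)
Let e (p : 'I_n * 'I_n) : nat := `|Num.max 0%R (a p.1 - a p.2 + 1)%R|%N.
Let b (i : 'I_n) : nat := `|(a i + 1)%R|%N.
Let I := {p : 'I_n * 'I_n & 'I_(e p)}.
Let J := ('I_k * {i : 'I_n & 'I_(b i)})%type.

Let endo (v : {ffun I -> F^o}) : 'M[{poly F}]_n :=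
  \matrix_(i, j) \sum_(t < e (i, j))
    (v (Tagged (fun p => 'I_(e p)) (i := (i, j)) t) : F) *: 'X^t.

(** This vanishes exactly when the endomorphism maps V to itself with matrix M. *)
Let defect (vM : {ffun I -> F^o} * 'M[F]_k) : 'M[{poly F}]_(n, k) :=
  endo vM.1 *m Y - Y *m constmx vM.2.

Lemma endo_linear (c : F) v w : endo (c *: v + w) = c%:P *: endo v + endo w.
Proof.
apply/matrixP=> i j; rewrite !mxE mulr_sumr -big_split; apply: eq_bigr => t _ /=.
by rewrite !ffunE scalerDl mul_polyC scalerA.
Qed.

Lemma endo_coef v i j (t : nat) : a i - a j < t%:Z -> (endo v i j)`_t = 0.
Proof.
move=> lt_t; rewrite mxE coef_sum big1 // => -[u hu] _; rewrite coefZ coefXn /=.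
case: eqP => [tu|_]; last by rewrite mulr0.
by move: hu; rewrite /e /= -tu; lia.
Qed.

Lemma endo_eq0 v : endo v = 0 -> v = 0.
Proof.
move=> v0; apply/ffunP => -[[i j] t]; rewrite [RHS]ffunE.
have := congr1 (fun A : 'M[{poly F}]_n => (A i j)`_t) v0; rewrite !mxE coef0 coef_sum.
rewrite (bigD1 t) //= coefZ coefXn eqxx mulr1 big1 ?addr0 // => u ut.
by rewrite coefZ coefXn eq_sym (inj_eq val_inj) (negPf ut) mulr0.
Qed.

Lemma defect_linear (c : F) v w : defect (c *: v + w) = c%:P *: defect v + defect w.
Proof.
rewrite /defect /= endo_linear map_mxD map_mxZ /=.
rewrite mulmxDl mulmxDr -scalemxAl -scalemxAr scalerBr.
by rewrite opprD addrACA.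
Qed.

(** The line spanned by the identity is cut away by adding an entry of M to the
    target: a kernel element (f, M) is a scalar c in both components by
    simplicity, and c is the chosen entry.  If the source were larger than the
    target, there would be a nonzero kernel element. *)
Lemma endo_count : (2 <= n)%N -> (0 < k)%N -> (n ^ 2 + k ^ 2)%:Z <= k%:Z * (d + n%:Z) + 1.
Proof.
move=> n2 k0; rewrite leNgt; apply/negP => lt.
pose l0 : 'I_k := Ordinal k0.
pose phi (vM : {ffun I -> F^o} * 'M[F]_k) : {ffun J -> F^o} * F^o :=
  ([ffun j : J => (defect vM (tag j.2) j.1)`_(tagged j.2)], vM.2 l0 l0).
have phi_lin : linear phi.
  move=> c v w; congr pair; last by rewrite /= !mxE.
  by apply/ffunP => j; rewrite !ffunE /= defect_linear !mxE mul_polyC coefD coefZ.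
have cJ : (#|{: J}|%:Z = k%:Z * (d + n%:Z)).
  rewrite card_prod card_ord card_sigma_ord PoszM; congr (_ * _).
  rewrite (big_morph Posz PoszD erefl).
  rewrite (eq_bigr (fun i => a i + 1)) => [|i _]; last first.
    by rewrite /b; have := split_nonneg i n2; lia.
  by rewrite big_split /= sum_a sumr_const card_ord natz.
have cI : n%:Z ^+ 2 <= #|{: I}|%:Z.
  rewrite card_sigma_ord (big_morph Posz PoszD erefl).
  apply: (@le_trans _ _ (\sum_(p : 'I_n * 'I_n) (a p.1 - a p.2 + 1))); last first.
    by apply: ler_sum => p _; rewrite /e; lia.
  (* The contributions of the a_i and of the a_j cancel. *)
  rewrite -(pair_bigA _ (fun i j => a i - a j + 1)) /=.
  have -> : \sum_i \sum_j (a i - a j + 1) = n%:Z ^+ 2; last by [].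
  under eq_bigr do rewrite big_split sumrB /= !sumr_const card_ord.
  rewrite big_split sumrB /= !sumr_const card_ord -sumrMnl subrr add0r.
  by rewrite !natz -mulr_natr natz expr2.
have [|vM vM0] := linear_kernel_neq0 phi_lin.
  change (#|{: J}| * 1 + 1 < #|{: I}| * 1 + k * k)%N.
  by rewrite !muln1; move: lt cI cJ; lia.
case=> /ffunP vJ M0.
have d0 : defect vM = 0.
  apply/matrixP=> i l; apply/polyP => t; rewrite [in RHS]mxE coef0.
  (* The target records the coefficients of degree at most a_i; the others
     vanish because the defect consists of sections. *)
  case: (ltP (a i) t%:Z) => ti; last first.
    have tb : (t < b i)%N by rewrite /b; lia.
    have := vJ (l, Tagged (fun i => 'I_(b i)) (Ordinal tb)).
    by rewrite !ffunE.
  have -> : defect vM i l = (endo vM.1 *m Y) i l - (Y *m constmx vM.2) i l by rewrite !mxE.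
  rewrite coefB; apply/eqP; rewrite subr_eq0; apply/eqP.
  transitivity (0 : F).
    rewrite mxE coef_sum big1 // => j _.
    rewrite coefM big1 // => u _.
    case: (ltP (a i - a j) (u : nat)%:Z) => h; first by rewrite endo_coef ?mul0r.
    rewrite split_sections ?mulr0 //.
    by have := ltn_ord u; move: h ti; lia.
  rewrite [_ (_ *m _) _ _]mxE coef_sum big1 // => j _.
  by rewrite [constmx _ _ _]mxE coefMC split_sections ?mul0r.
have [|c ec] := split_simple (@endo_coef vM.1) (M := vM.2).
  by apply/eqP; rewrite -subr_eq0; apply/eqP.
have eM : vM.2 = c%:M.
  apply/eqP; rewrite -subr_eq0; apply/eqP/matrixP => i j; rewrite [RHS]mxE.
  set N := _ - _; suff : col j N = 0 by move/colP/(_ i); rewrite !mxE.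
  apply: fr.2; rewrite map_col colE mulmxA.
  suff -> : B0 *m constmx N = 0 by rewrite mul0mx.
  move: d0; rewrite /defect ec => /eqP; rewrite subr_eq0 => /eqP e0.
  have YN : Y *m constmx N = 0.
    by rewrite map_mxB map_scalar_mx mulmxBr -e0 mul_mx_scalar mul_scalar_mx subrr.
  by rewrite -[B0](mulKVmx uP) -/Y -mulmxA YN mulmx0.
have c0 : c = 0 by move: M0; rewrite eM !mxE eqxx.
move/eqP: vM0; case; rewrite [vM]surjective_pairing eM c0.
by rewrite (@endo_eq0 vM.1) ?ec ?c0 // raddf0.
Qed.
End count.

Theorem corollary3p3 (F : closedFieldType) (R : realType) (n : nat) (d : int)
    (k : nat) (alpha : R) (hn : (2 <= n)%N) (hk : (0 < k)%N)
    (hG : moduli F alpha n d k !=set0) :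
  (d%:~R : R) >= 1 / k%:R * (n%:R ^+ 2 - 1) - (n%:R - k%:R).
Proof.
have [_ [X st _]] := hG.
have [B0 [B1 [fr eV]]] := frame_of_cohsys X.
have [a [P [Q [uP uQ sum_a eE]]]] := Birkhoff_Grothendieck (bundle X).
have cnt := endo_count st fr eV uP uQ eE sum_a hn hk.
have k0 : 0 < k%:R :> R by rewrite ltr0n.
have : ((n ^ 2 + k ^ 2)%N%:Z)%:~R <= (k%:Z * (d + n%:Z) + 1)%:~R :> R by rewrite ler_int.
rewrite PoszD !intrD intrM intrD /= -!pmulrn !natrX => h.
rewrite lerBlDr mul1r mulrC ler_pdivrMr //.
nra.
Qed.
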